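(* Let $m\ge 2$ be an integer and let $R$ be a ring. Every strongly $m$-nil clean element of $R$ is a strongly $\pi$-regular element of $R$.
   Context: Rings are associative with identity. An element $f$ is $m$-potent if $f^m=f$. An element $a\in R$ is strongly $m$-nil clean if $a=f+n$ with $f$ an $m$-potent, $n$ a nilpotent and $fn=nf$. An element $a\in R$ is strongly $\pi$-regular if it has a strongly $\pi$-regular decomposition, i.e. $a=f+u$ with $f$ an idempotent and $u$ a unit of $R$ such that $af=fa$ and $faf$ is nilpotent. *)

(* Defs.v *)
From mathcomp Require Import all_boot all_order all_algebra.

Set Implicit Arguments.
Unset Strict Implicit.
Unset Printing Implicit Defensive.

Import GRing.Theory.
Local Open Scope ring_scope.

(* [pzRingType]: associative rings with identity, not assumed commutative;
   the zero ring is allowed. *)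

Definition m_potent (R : pzRingType) (m : nat) (f : R) : Prop := f ^+ m = f.

Definition idempotent_elt (R : pzRingType) (f : R) : Prop := f * f = f.

Definition nilpotent_elt (R : pzRingType) (x : R) : Prop :=
  exists k : nat, x ^+ k = 0.

(* [GRing.unit] needs a [unitRingType], i.e. a nonzero ring with a decision
   procedure for invertibility and a chosen inverse function; an arbitrary ring
   carries no such structure, so two-sided invertibility is stated directly. *)
Definition unit_elt (R : pzRingType) (u : R) : Prop :=
  exists v : R, v * u = 1 /\ u * v = 1.

Definition strongly_m_nil_clean (R : pzRingType) (m : nat) (a : R) : Prop :=
  exists f n : R,
    [/\ a = f + n, m_potent m f, nilpotent_elt n & f * n = n * f].

Definition strongly_pi_regular (R : pzRingType) (a : R) : Prop :=
  exists f u : R,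
    [/\ a = f + u, idempotent_elt f, unit_elt u, a * f = f * a
      & nilpotent_elt (f * a * f)].

(* Main.v *)
Require Import Defs.
From mathcomp Require Import all_boot all_order all_algebra.

(** Let a = f + n with f^m = f, n nilpotent and f n = n f.  The power
    e = f^(m-1) is an idempotent that acts as an identity on f, so f is
    invertible inside the corner e R e (with inverse f^(m-2) e) and vanishes
    on the complementary corner cut out by p = 1 - e.  Hence f - p is a unit
    of R, being f on one corner and -1 on the other, and a - p = (f - p) + n
    is a unit because a nilpotent commuting with a unit may be added to it
    ([unit_elt_add_nilpotent]).  Since p f = 0, the compression p a p is p n,
    which is nilpotent because p and n commute.  So a = p + (a - p) is the
    required decomposition. *)

Set Implicit Arguments.
Unset Strict Implicit.
Unset Printing Implicit Defensive.

Import GRing.Theory.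
Local Open Scope ring_scope.

Lemma nilpotent_elt_mul_comm (R : pzRingType) (x y : R) :
  GRing.comm x y -> nilpotent_elt y -> nilpotent_elt (x * y).
Proof. by move=> cxy [k yk0]; exists k; rewrite exprMn_comm // yk0 mulr0. Qed.

Lemma unit_elt_mul (R : pzRingType) (x y : R) :
  unit_elt x -> unit_elt y -> unit_elt (x * y).
Proof.
move=> [x' [x'x xx']] [y' [y'y yy']]; exists (y' * x'); split.
  by rewrite mulrA -(mulrA y') x'x mulr1.
by rewrite mulrA -(mulrA x) yy' mulr1.
Qed.

(** The inverse of 1 - x is the geometric series 1 + x + x^2 + ..., which is
    finite when x is nilpotent. *)
Lemma unit_elt_one_sub_nilpotent (R : pzRingType) (x : R) :
  nilpotent_elt x -> unit_elt (1 - x).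
Proof.
move=> [k xk0]; pose s := \sum_(i < k) x ^+ i.
have inv_r : (1 - x) * s = 1 by rewrite -opprB mulNr -subrX1 xk0 sub0r opprK.
have cxs : GRing.comm (1 - x) s.
  apply: commr_sum => i _; apply: commrX; apply/commr_sym.
  by apply: commrB; [exact: commr1 | exact: commr_refl].
by exists s; rewrite -cxs.
Qed.

(** If v is the inverse of w, then w + n = w (1 - x) with x = - v n, and x is
    nilpotent because v commutes with everything that w commutes with. *)
Lemma unit_elt_add_nilpotent (R : pzRingType) (w n : R) :
  unit_elt w -> nilpotent_elt n -> GRing.comm w n -> unit_elt (w + n).
Proof.
move=> uw nil_n cwn; have [v [vw wv]] := uw.
have cvn : GRing.comm v n.
  by rewrite /GRing.comm -[LHS]mulr1 -wv mulrA -(mulrA v n) -cwn mulrA vw mul1r.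
have -> : w + n = w * (1 - (- v * n)).
  by rewrite mulNr opprK mulrDr mulr1 mulrA wv mul1r.
apply: unit_elt_mul => //; apply: unit_elt_one_sub_nilpotent.
apply: nilpotent_elt_mul_comm => //.
by apply/commr_sym/commrN/commr_sym.
Qed.

Theorem proposition3p18 (m : nat) (hm : (2 <= m)%N) (R : pzRingType) (a : R) :
  strongly_m_nil_clean m a -> strongly_pi_regular a.
Proof.
case: m hm => [|[|k]] // _ [f [n [-> fm nil_n cfn]]].
rewrite /m_potent in fm.
pose e := f ^+ k.+1; pose p := 1 - e.
have fe : f * e = f by rewrite -exprS fm.
have ef : e * f = f by rewrite -exprSr fm.
have ee : e * e = e by rewrite {1}/e exprSr -mulrA fe -exprSr.
have pp : p * p = p by rewrite /p mulrBr mulr1 mulrBl mul1r ee subrr subr0.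
have pe : p * e = 0 by rewrite mulrBl mul1r ee subrr.
have ep : e * p = 0 by rewrite mulrBr mulr1 ee subrr.
have pf : p * f = 0 by rewrite mulrBl mul1r ef subrr.
have fp : f * p = 0 by rewrite mulrBr mulr1 fe subrr.
have cpn : GRing.comm p n.
  apply/commr_sym/commrB; first exact: commr1.
  exact/commrX/commr_sym.
have eDp : e + p = 1 by rewrite addrC subrK.
(* With p transparent, distributivity would also rewrite inside 1 - e. *)
clearbody p.
(* On the corner of e the inverse of f is g = f^(m-2) e; the factor e is there
   for m = 2, where f^(m-2) alone is 1. *)
pose g := f ^+ k * e.
have fg : f * g = e by rewrite mulrA -exprS ee.
have gf : g * f = e by rewrite -mulrA ef -exprSr.
have gp : g * p = 0 by rewrite -mulrA ep mulr0.
have pg : p * g = 0.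
  have cep : f ^+ k * e = e * f ^+ k by rewrite -exprD addnC exprD.
  by rewrite /g cep mulrA pe mul0r.
have unit_fp : unit_elt (f - p).
  exists (g - p); split.
    by rewrite mulrBr !mulrBl gf pf gp pp subr0 sub0r opprK eDp.
  by rewrite mulrBr !mulrBl fg pg fp pp subr0 sub0r opprK eDp.
exists p, (f + n - p); split.
- by rewrite [RHS]addrC subrK.
- exact: pp.
- rewrite addrAC; apply: unit_elt_add_nilpotent => //.
  by apply/commr_sym/commrB; exact/commr_sym.
- by rewrite mulrDl mulrDr pf fp cpn.
- have -> : p * (f + n) * p = p * n.
    by rewrite mulrDr pf add0r -mulrA -cpn mulrA pp.
  exact: nilpotent_elt_mul_comm.
Qed.
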